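(* Let $0\le\gamma\le 2$, and let $\omega$, $n$ and $\Lambda$ (the cosmological constant) be constants. Consider the Sáez-Ballester cosmological equations with cosmological constant $$3H^2=\rho_m+\tfrac{\omega}{2}\phi^n\dot\phi^2+\Lambda,\quad 2\dot H=-\gamma\rho_m-\omega\phi^n\dot\phi^2,\quad \ddot\phi+3H\dot\phi+\tfrac n2\frac{\dot\phi^2}{\phi}=0,\quad \dot\rho_m+3\gamma H\rho_m=0 .$$ Then $\Omega_m:=\rho_m/(3H^2)$ and $\Omega_\Lambda:=\Lambda/(3H^2)$ satisfy the autonomous system $$\Omega_m'=3(2-\gamma)\Omega_m(1-\Omega_m)-6\,\Omega_m\Omega_\Lambda,\qquad \Omega_\Lambda'=6\,\Omega_\Lambda(1-\Omega_\Lambda)-3(2-\gamma)\,\Omega_\Lambda\Omega_m ,$$ with phase space the triangular region $$\Psi=\{(\Omega_m,\Omega_\Lambda):\ \Omega_m+\Omega_\Lambda\le1,\ 0\le\Omega_m\le1,\ 0\le\Omega_\Lambda\le1\}.$$ The critical points $(\Omega_m,\Omega_\Lambda)$ of this system, all of which always exist, are: (i) $A=(0,0)$ (stiff matter), which is unstable (past attractor), with $q=2$; (ii) $B=(1,0)$ (matter dominance), which is a saddle point, with $q=-1+\tfrac{3\gamma}{2}$; (iii) $C=(0,1)$ (de Sitter), which is stable (future attractor), with $q=-1$.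
   Context: Dots denote derivatives with respect to cosmic time $t$; the prime denotes the derivative with respect to $\tau=\int H\,dt$, i.e. $f'=\dot f/H$. $H\ge 0$ is the Hubble parameter of a flat Friedmann-Robertson-Walker metric (only expanding universes are considered), $\rho_m$ is the energy density of a fluid with pressure $p_m=(\gamma-1)\rho_m$, where $\gamma$ is its barotropic index, and $\phi$ is the Sáez-Ballester scalar field. The deceleration parameter is $q=-1-\dot H/H^2$, where $\dot H/H^2=-3(1-\Omega_\Lambda)+\tfrac{3(2-\gamma)}{2}\Omega_m$.
   Formalization: At γ=0 all points of Ω_m+Ω_Λ=1, and at γ=2 all of Ω_Λ=0, are critical, so ''the critical points are A, B, C'' and ''B is a saddle'' are claimed for 0<γ<2 only, ''A is a past attractor'' for γ<2, ''C is a future attractor'' for γ>0. *)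

(* Defs.v *)
From HB Require Import structures.
From mathcomp Require Import all_boot all_order all_algebra.
From mathcomp Require Import all_classical all_reals all_analysis.
Set Implicit Arguments.
Unset Strict Implicit.
Unset Printing Implicit Defensive.
Import Order.TTheory GRing.Theory Num.Theory.
Import numFieldNormedType.Exports.
Local Open Scope ring_scope.
Local Open Scope classical_set_scope.

(* [x ^ a] for a real exponent.  The library's [powR] is the right function
   only for [0 <= x]; for an integer exponent we use integer powers, so that
   negative bases are covered as well.  The two agree when [0 < x]. *)
Definition rpow (R : realType) (x a : R) : R :=
  if a \is a Num.int then x ^ (Num.floor a) else x `^ a.

(* [(H, rho, phi)] solves the field equations on the time domain [I], in an
   expanding universe.  The side condition on [phi t] says exactly that
   [phi ^ n] and [phi' ^ 2 / phi] are meaningful. *)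
Record saez_ballester (R : realType) (gamma omega n Lambda : R)
    (I : set R) (H rho phi : R -> R) : Prop := SaezBallester {
  sb_derivable_H : forall t, I t -> derivable H t 1;
  sb_derivable_rho : forall t, I t -> derivable rho t 1;
  sb_derivable_phi : forall t, I t -> derivable phi t 1;
  sb_derivable_dphi : forall t, I t -> derivable (derive1 phi) t 1;
  sb_expanding : forall t, I t -> 0 <= H t;
  sb_phi_domain : forall t, I t ->
    0 < phi t \/ (phi t != 0 /\ n \is a Num.int);
  sb_friedmann : forall t, I t ->
    3 * H t ^+ 2
    = rho t + omega / 2 * rpow (phi t) n * derive1 phi t ^+ 2 + Lambda;
  sb_raychaudhuri : forall t, I t ->
    2 * derive1 H t
    = - gamma * rho t - omega * rpow (phi t) n * derive1 phi t ^+ 2;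
  sb_scalar : forall t, I t ->
    derive1 (derive1 phi) t + 3 * H t * derive1 phi t
    + n / 2 * (derive1 phi t ^+ 2 / phi t) = 0;
  sb_continuity : forall t, I t ->
    derive1 rho t + 3 * gamma * H t * rho t = 0 }.

Definition Omega_m (R : realType) (H rho : R -> R) : R -> R :=
  fun t => rho t / (3 * H t ^+ 2).

Definition Omega_L (R : realType) (Lambda : R) (H : R -> R) : R -> R :=
  fun t => Lambda / (3 * H t ^+ 2).

(* derivative with respect to tau, where [d tau = H d t] *)
Definition tau_derive (R : realType) (H f : R -> R) (t : R) : R :=
  derive1 f t / H t.

(* the system, as a vector field on the [(Omega_m, Omega_L)] plane *)
Definition vfield (R : realType) (gamma : R) (p : R * R) : R * R :=
  (3 * (2 - gamma) * p.1 * (1 - p.1) - 6 * p.1 * p.2,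
   6 * p.2 * (1 - p.2) - 3 * (2 - gamma) * p.2 * p.1).

Definition Psi (R : realType) : set (R * R) :=
  [set p | p.1 + p.2 <= 1 /\ 0 <= p.1 <= 1 /\ 0 <= p.2 <= 1].

(* [-1 - H'/H^2], with [H'/H^2] expressed in [(Omega_m, Omega_L)] *)
Definition deceleration (R : realType) (gamma : R) (p : R * R) : R :=
  - 1 - (- 3 * (1 - p.2) + 3 * (2 - gamma) / 2 * p.1).

Section PlanarSystem.
Variables (R : realType) (F : R * R -> R * R).
Implicit Types (J : set R) (X : set (R * R)) (z : R -> R * R) (p : R * R).

Definition solves J z := forall tau, J tau -> is_derive tau 1 z (F (z tau)).

Definition trajectory X z := solves setT z /\ forall tau, X (z tau).

(* [X] is a state space on which [F] generates a flow: solutions on open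
   intervals cannot enter or leave [X], and through every point of [X] there
   is a solution defined for all times.  The latter is what makes
   quantification over complete trajectories harmless below. *)
Definition phase_space X :=
  (forall J z, open J -> is_interval J -> solves J z ->
     forall s tau, J s -> J tau -> X (z s) -> X (z tau)) /\
  (forall p, X p -> exists2 z, trajectory X z & z 0 = p).

Definition critical_point p := F p = 0.

Definition lyapunov_stable X p :=
  forall e : R, 0 < e -> exists2 d : R, 0 < d &
    forall z, trajectory X z -> `|z 0 - p| < d ->
      forall tau, 0 <= tau -> `|z tau - p| < e.

Definition unstable X p := ~ lyapunov_stable X p.

(* asymptotic stability *)
Definition future_attractor X p :=
  lyapunov_stable X p /\
  exists2 d : R, 0 < d &
    forall z, trajectory X z -> `|z 0 - p| < d -> z tau @[tau --> +oo] --> p.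

(* [a] is an eigenvalue of the linearization of [F] at [p] *)
Definition lin_eigenvalue p (a : R) :=
  exists2 v : R * R, v != 0 & 'd F p v = a *: v.

Definition saddle_point p :=
  [/\ critical_point p, differentiable F p &
      exists a b, [/\ a < 0, 0 < b, lin_eigenvalue p a & lin_eigenvalue p b]].

End PlanarSystem.

(* attractor of the time-reversed system *)
Definition past_attractor (R : realType) (F : R * R -> R * R) X p :=
  future_attractor (fun x => - F x) X p.

(* Main.v *)
(* The system is the replicator equation for the densities x = Omega_m,
   y = Omega_L and w = 1 - x - y of three components that scale like
   e^(-3 gamma tau), 1 and e^(-6 tau).  Each of x, y, w solves a linear equation
   f' = g f along a solution, hence keeps its sign, and normalizing the three
   exponentials gives the complete solutions.  On the triangle 1 - y is a
   Lyapunov function at C, and x + y is one at A for the reversed time; both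
   decay exponentially near the respective point.  Near A, y grows at least
   like e^(3 tau).  At B the linearization has the eigenvectors (1, 0) and
   (1, -1), with eigenvalues -3 (2 - gamma) and 3 gamma. *)

Require Import Defs.
From mathcomp Require Import all_boot all_order all_algebra.
From mathcomp Require Import all_classical all_reals all_analysis.
From mathcomp Require Import ring lra.
Set Implicit Arguments.
Unset Strict Implicit.
Unset Printing Implicit Defensive.
Import Order.TTheory GRing.Theory Num.Theory.
Import numFieldNormedType.Exports.
Local Open Scope ring_scope.
Local Open Scope classical_set_scope.

(** * Derivatives of maps into a product *)

Section ProductDerivative.
Variables (R : realType) (V W1 W2 : normedModType R).
Implicit Types (x v : V).

(** Replaces a limit value by convergence of the difference quotient, which can be checked
    coordinate by coordinate in a product. *)
Lemma is_derive_cvgP (W : normedModType R) (f : V -> W) x v df :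
  is_derive x v f df <->
  h^-1 *: (f (h *: v + x) - f x) @[h --> 0^'] --> df.
Proof.
split=> [[fD <-] //|fdf].
by apply: DeriveDef; [apply/cvg_ex; exists df|exact: cvg_lim fdf].
Qed.

Lemma is_derive_pair (f : V -> W1) (g : V -> W2) x v df dg :
  is_derive x v f df -> is_derive x v g dg ->
  is_derive x v (fun y => (f y, g y)) (df, dg).
Proof.
by move=> /is_derive_cvgP cf /is_derive_cvgP cg; apply/is_derive_cvgP/cvg_pair.
Qed.

Lemma is_derive_fst (f : V -> W1 * W2) x v df :
  is_derive x v f df -> is_derive x v (fst \o f) df.1.
Proof.
move=> /is_derive_cvgP cf; apply/is_derive_cvgP.
exact: (cvg_comp _ _ cf cvg_fst).
Qed.

Lemma is_derive_snd (f : V -> W1 * W2) x v df :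
  is_derive x v f df -> is_derive x v (snd \o f) df.2.
Proof.
move=> /is_derive_cvgP cf; apply/is_derive_cvgP.
exact: (cvg_comp _ _ cf cvg_snd).
Qed.

End ProductDerivative.

(** * Grönwall estimates and linear scalar equations *)

Section DifferentialInequalities.
Variable R : realType.
Implicit Types (f df g : R -> R) (a b c t : R) (J : set R).

Lemma is_derive_continuous f t d : is_derive t 1 f d -> {for t, continuous f}.
Proof.
by case=> fD _; apply: differentiable_continuous; apply/derivable1_diffP.
Qed.

Lemma is_derive_expRM c t :
  is_derive t 1 (fun s => expR (c * s)) (c * expR (c * t)).
Proof.
have cD : is_derive t 1 (fun s : R => c * s) c.
  by apply: is_derive_eq; rewrite /GRing.scale /= mulr1.
have := is_derive1_comp (is_derive_expR (c * t)) cD.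
by rewrite mulrC.
Qed.

Lemma le_of_derive_le0 f df a b : a <= b ->
  (forall t, a <= t <= b -> is_derive t 1 f (df t)) ->
  (forall t, a <= t <= b -> df t <= 0) -> f b <= f a.
Proof.
move=> ab fD df0.
have cf : {within `[a, b], continuous f}.
  apply: continuous_in_subspaceT => t /[!inE]/=; rewrite in_itv /=.
  by move=> /fD; exact: is_derive_continuous.
have [t|c /[!in_itv]/= cab fE] := @MVT_segment _ f df a b ab _ cf.
  by rewrite in_itv /= => /andP[? ?]; apply: fD; rewrite !ltW.
by rewrite -subr_le0 fE mulr_le0_ge0 ?df0 ?subr_ge0.
Qed.

(** Grönwall: [f t * expR (- c * t)] has derivative [expR (- c * t) * (df t - c * f t)], hence is
    nonincreasing. Applied to [- f], it gives lower bounds. *)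
Lemma le_expR_of_derive_le f df c a b : a <= b ->
  (forall t, a <= t <= b -> is_derive t 1 f (df t)) ->
  (forall t, a <= t <= b -> df t <= c * f t) ->
  f b <= f a * expR (c * (b - a)).
Proof.
move=> ab fD dfc.
have : f b * expR (- c * b) <= f a * expR (- c * a).
  apply: (@le_of_derive_le0 (f * (fun s => expR (- c * s)))
    (fun t => f t *: (- c * expR (- c * t)) + expR (- c * t) *: df t)
    a b ab) => t tab.
    by apply: is_deriveM; [exact: fD|exact: is_derive_expRM].
  rewrite /GRing.scale /=.
  rewrite [leLHS](_ : _ = expR (- c * t) * (df t - c * f t)); last ring.
  by rewrite mulr_ge0_le0 ?expR_ge0// subr_le0 dfc.
rewrite -(ler_pM2r (expR_gt0 (c * b))) -!mulrA -!expRD.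
by rewrite mulNr addNr expR0 mulr1 mulNr addrC -mulrBr.
Qed.

(* Both implications are Gronwall estimates for [f ^+ 2]. *)
Lemma linear_ode_eq0 f g a b : a <= b ->
  (forall t, a <= t <= b -> is_derive t 1 f (g t * f t)) ->
  (forall t, a <= t <= b -> {for t, continuous g}) ->
  f a = 0 <-> f b = 0.
Proof.
move=> ab fD gC.
have cg : {within `[a, b], continuous g}.
  by apply: continuous_in_subspaceT => t /[!inE]/=; rewrite in_itv /= => /gC.
have f2D t : a <= t <= b ->
    is_derive t 1 (fun u => f u ^+ 2) (2 * g t * f t ^+ 2).
  move=> /fD fDt; rewrite (_ : (fun u => f u ^+ 2) = f * f); last first.
    by apply/funext => u; rewrite expr2.
  by apply: is_derive_eq; rewrite /GRing.scale /=; ring.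
split=> f0; apply/eqP; rewrite -sqrf_eq0 eq_le sqr_ge0 andbT.
  have [m _ gm] := EVT_max ab cg.
  have := @le_expR_of_derive_le _ _ (2 * g m) _ _ ab f2D.
  rewrite /= f0 expr0n mul0r; apply=> t tab.
  by rewrite ler_wpM2r ?sqr_ge0// ler_wpM2l// gm// in_itv.
(* Passing to [- f ^+ 2] turns the lower bound of [g] into an upper growth bound, which propagates
   the zero from [b] back to [a]. *)
have [m _ gm] := EVT_min ab cg.
have Nf2D t (tab : a <= t <= b) :
    is_derive t 1 (fun u => - f u ^+ 2) (- (2 * g t * f t ^+ 2)).
  exact: is_deriveN (f2D t tab).
have := @le_expR_of_derive_le _ _ (2 * g m) _ _ ab Nf2D.
rewrite /= f0 expr0n oppr0 mulNr oppr_ge0.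
rewrite pmulr_lle0 ?expR_gt0//; apply=> t tab.
by rewrite mulrN lerN2 ler_wpM2r ?sqr_ge0// ler_wpM2l// gm// in_itv.
Qed.

(** A change of sign would produce a zero in [J], and by uniqueness a zero at one point of [J]
    spreads to all of [J]. *)
Lemma linear_ode_ge0 f g J s t : is_interval J ->
  (forall u, J u -> is_derive u 1 f (g u * f u)) ->
  (forall u, J u -> {for u, continuous g}) ->
  J s -> J t -> 0 <= f s -> 0 <= f t.
Proof.
move=> iJ fD gC Js Jt fs0; rewrite leNgt; apply/negP => ft0.
have eq0 a b : J a -> J b -> f a = 0 -> f b = 0.
  move=> Ja Jb; have [ab|/ltW ba] := leP a b.
    by apply: (linear_ode_eq0 (f := f) (g := g) ab _ _).1 => u;
      move=> /(iJ _ _ Ja Jb); [exact: fD|exact: gC].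
  by apply: (linear_ode_eq0 (f := f) (g := g) ba _ _).2 => u;
    move=> /(iJ _ _ Jb Ja); [exact: fD|exact: gC].
have cf a b : J a -> J b -> {within `[a, b], continuous f}.
  move=> Ja Jb; apply: continuous_in_subspaceT => u /[!inE]/=.
  by rewrite in_itv /= => /(iJ _ _ Ja Jb)/fD; exact: is_derive_continuous.
have [c Jc fc0] : exists2 c, J c & f c = 0.
  have [st|/ltW ts] := leP s t.
    have [|c] := IVT st (cf _ _ Js Jt) (v := 0).
      by rewrite ge_min le_max fs0 (ltW ft0) orbT.
    by rewrite in_itv /= => /(iJ _ _ Js Jt); exists c.
  have [|c] := IVT ts (cf _ _ Jt Js) (v := 0).
    by rewrite ge_min le_max fs0 (ltW ft0) orbT.
  by rewrite in_itv /= => /(iJ _ _ Jt Js); exists c.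
by move: ft0; rewrite (eq0 c t)// ltxx.
Qed.

Lemma cvg_expR_decay (V : normedModType R) (z : R -> V) p c K : 0 < c ->
  (forall t, 0 <= t -> `|z t - p| <= K * expR (- c * t)) ->
  z t @[t --> +oo] --> p.
Proof.
move=> c0 zp.
apply/cvgrPdist_lt => e e0.
have K0 : 0 <= K.
  have := zp 0 (lexx _); rewrite mulr0 expR0 mulr1; exact: le_trans.
near=> t.
have t0 : 0 < t by near: t; exact: (nbhs_pinfty_gt (num_real _)).
(* The threshold comes from [1 + c * t <= expR (c * t)]: once K < e c t, also K e^(-ct) < e. *)
have tK : K / (e * c) < t by near: t; exact: (nbhs_pinfty_gt (num_real _)).
rewrite distrC (le_lt_trans (zp t (ltW t0)))// mulNr expRN.
rewrite ltr_pdivrMr ?expR_gt0//.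
have := expR_ge1Dx (c * t).
move: tK; rewrite ltr_pdivrMr ?mulr_gt0// => tK ct.
rewrite (lt_le_trans tK)// [leLHS](_ : _ = e * (c * t)); last ring.
by rewrite ler_pM2l//; lra.
Unshelve. all: by end_near. Qed.

End DifferentialInequalities.

(** * Invariance of the triangle and complete trajectories *)

Section Flow.
Variables (R : realType) (gamma : R).
Hypotheses (gamma_ge0 : 0 <= gamma) (gamma_le2 : gamma <= 2).
Local Notation F := (vfield gamma).
Local Notation P := (@Psi R).
Implicit Types (z : R -> R * R) (p : R * R) (s t : R) (J : set R).

Let two_sub_gamma_ge0 : 0 <= 2 - gamma.
Proof. by rewrite subr_ge0. Qed.

(** Symmetric description by the three densities x, y and w = 1 - x - y; the upper bounds follow
    from their sum being 1. *)
Lemma PsiP p : P p <-> [/\ 0 <= p.1, 0 <= p.2 & 0 <= 1 - p.1 - p.2].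
Proof.
split=> [[? [/andP[? ?] /andP[? ?]]]|[? ? ?]]; first by split=> //; lra.
by split; [lra|split; lra].
Qed.

(** Factoring out each coordinate exhibits the linear form f' = g f and splits the equation for
    critical points into cases. *)
Lemma vfield_nullclines p : F p =
  (p.1 * (3 * (2 - gamma) - 3 * (2 - gamma) * p.1 - 6 * p.2),
   p.2 * (6 - 3 * (2 - gamma) * p.1 - 6 * p.2)).
Proof. by rewrite /vfield; congr pair; ring. Qed.

Lemma is_derive_stiff z t (G : R * R) : is_derive t 1 z G ->
  is_derive t 1 (fun s => 1 - (z s).1 - (z s).2) (- G.1 - G.2).
Proof.
move=> zD; have xD := is_derive_fst zD; have yD := is_derive_snd zD.
have := is_deriveB (is_deriveB (is_derive_cst (1 : R) t 1) xD) yD.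
by rewrite sub0r.
Qed.

Lemma solves_Psi J z s t : is_interval J -> solves F J z ->
  J s -> J t -> P (z s) -> P (z t).
Proof.
move=> iJ zS Js Jt /PsiP[x0 y0 w0].
(* The growth rates of x, y and w are all affine in x and y, so one continuity statement serves the
   three. *)
have gC a b c u : J u ->
    {for u, continuous (fun r => a - b * (z r).1 - c * (z r).2)}.
  move=> /zS zD.
  have xC := is_derive_continuous (is_derive_fst zD).
  have yC := is_derive_continuous (is_derive_snd zD).
  by apply: cvgB; [apply: cvgB; [exact: cvg_cst|]|];
    apply: cvgM => //; exact: cvg_cst.
apply/PsiP; split.
- apply: (@linear_ode_ge0 _ (fst \o z) _ _ _ _ iJ _ (gC _ _ _) Js Jt x0).
  by move=> u /zS; rewrite vfield_nullclines mulrC => /is_derive_fst; exact.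
- apply: (@linear_ode_ge0 _ (snd \o z) _ _ _ _ iJ _ (gC _ _ _) Js Jt y0).
  by move=> u /zS; rewrite vfield_nullclines [X in (_, X)]mulrC
    => /is_derive_snd; exact.
(* Adding the two equations gives w' = - (3 (2 - gamma) x + 6 y) w. *)
- apply: (@linear_ode_ge0 _ (fun r => 1 - (z r).1 - (z r).2) _ _ _ _ iJ _
    (gC 0 (3 * (2 - gamma)) 6) Js Jt w0).
  move=> u /zS /is_derive_stiff /is_derive_eq; apply; rewrite /vfield /=; ring.
Qed.

(* The fluid, the cosmological constant and the stiff scalar field scale as
   [e^(-3 gamma tau)], [1] and [e^(-6 tau)]; the solution is their
   normalization. *)
Lemma Psi_flow p : P p -> exists2 z, trajectory F P z & z 0 = p.
Proof.
move=> /PsiP[x0 y0 w0].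
pose m t := p.1 * expR (- (3 * gamma) * t).
pose w t := (1 - p.1 - p.2) * expR (- 6 * t).
pose D t := m t + p.2 + w t.
have m_ge0 t : 0 <= m t by rewrite mulr_ge0 ?expR_ge0.
have w_ge0 t : 0 <= w t by rewrite mulr_ge0 ?expR_ge0.
have D_gt0 t : 0 < D t.
  (* If [D t] vanished, so would all three initial densities, whose sum is 1. *)
  rewrite lt_neqAle 2?addr_ge0// andbT eq_sym; apply/eqP => D0.
  have {D0}[m0 y00 w00] : [/\ m t = 0, p.2 = 0 & w t = 0].
    by have := m_ge0 t; have := w_ge0 t; move: D0; rewrite /D; split; lra.
  move/eqP: m0; rewrite mulf_eq0 expR_eq0 orbF => /eqP m0.
  move/eqP: w00; rewrite mulf_eq0 expR_eq0 orbF => /eqP.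
  by rewrite m0 y00 !subr0 => /eqP; rewrite oner_eq0.
have mD t : is_derive t 1 m (- (3 * gamma) * m t).
  have := is_deriveZ p.1 (is_derive_expRM (- (3 * gamma)) t).
  by rewrite /GRing.scale /= mulrCA.
have wD t : is_derive t 1 w (- 6 * w t).
  have := is_deriveZ (1 - p.1 - p.2) (is_derive_expRM (- 6) t).
  by rewrite /GRing.scale /= mulrCA.
have DD t : is_derive t 1 D (- (3 * gamma) * m t - 6 * w t).
  have := is_deriveD (is_deriveD (mD t) (is_derive_cst p.2 t 1)) (wD t).
  by rewrite addr0 mulNr.
have VD t := is_deriveV (lt0r_neq0 (D_gt0 t)) (DD t).
exists (fun t => (m t / D t, p.2 / D t)).
  split=> [t _|t].
    have := is_derive_pair (is_deriveM (mD t) (VD t))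
      (is_deriveZ p.2 (VD t)).
    move=> /is_derive_eq; apply; rewrite /vfield /GRing.scale /=.
    have Dn0 := lt0r_neq0 (D_gt0 t).
    by congr pair; move: Dn0; rewrite /D => ?; field.
  apply/PsiP; split; rewrite /= ?divr_ge0 ?(ltW (D_gt0 t))//.
  have -> : 1 - m t / D t - p.2 / D t = w t / D t.
    by have := lt0r_neq0 (D_gt0 t); rewrite /D => ?; field.
  by rewrite divr_ge0 ?(ltW (D_gt0 t)).
rewrite /D /m /w !mulr0 expR0 !mulr1.
have -> : p.1 + p.2 + (1 - p.1 - p.2) = 1 by ring.
by rewrite !divr1 -surjective_pairing.
Qed.

Lemma phase_space_Psi : phase_space F P.
Proof.
by split=> [J z _ iJ zS s t|]; [exact: solves_Psi|exact: Psi_flow].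
Qed.

Lemma trajectory_Psi G z t : trajectory G P z ->
  [/\ 0 <= (z t).1, 0 <= (z t).2 & 0 <= 1 - (z t).1 - (z t).2].
Proof. by move=> [_ zP]; apply/PsiP; exact: zP. Qed.

(** The product carries the maximum norm. *)
Lemma norm_pair_sub_lt (p q : R * R) e :
  (`|p - q| < e) = (`|p.1 - q.1| < e) && (`|p.2 - q.2| < e).
Proof. by rewrite prod_normE /= gt_max. Qed.

Lemma norm_pair_sub_le (p q : R * R) e :
  (`|p - q| <= e) = (`|p.1 - q.1| <= e) && (`|p.2 - q.2| <= e).
Proof. by rewrite prod_normE /= ge_max. Qed.

(** * Stability of the de Sitter point C *)

Lemma is_derive_deSitter z t : trajectory F P z ->
  is_derive t 1 (fun s => 1 - (z s).2)
    (- ((z t).2 * (6 - 3 * (2 - gamma) * (z t).1 - 6 * (z t).2))).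
Proof.
move=> [zS _]; have zD := zS t Logic.I.
have := is_deriveB (is_derive_cst (1 : R) t 1) (is_derive_snd zD).
by rewrite vfield_nullclines sub0r.
Qed.

(** On the triangle the growth rate of y equals 6 w + 3 gamma x, which is nonnegative. *)
Lemma nonincreasing_deSitter z s t : trajectory F P z -> s <= t ->
  1 - (z t).2 <= 1 - (z s).2.
Proof.
move=> zT st.
apply: (le_of_derive_le0 st (fun u _ => is_derive_deSitter u zT)) => u _.
have [x0 y0 w0] := trajectory_Psi u zT.
rewrite oppr_le0 mulr_ge0//.
have : 0 <= 3 * gamma * (z u).1 by rewrite !mulr_ge0.
lra.
Qed.

(** On the triangle x <= 1 - y, so the distance to C is the Lyapunov function 1 - y itself.
    Stability then holds with equal radii. *)
Lemma deSitter_norm_lt z t e : trajectory F P z ->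
  (`|z t - (0, 1)| < e) = (1 - (z t).2 < e).
Proof.
move=> /(trajectory_Psi t)[x0 y0 w0]; rewrite norm_pair_sub_lt /= subr0.
rewrite (ger0_norm x0) distrC ger0_norm; last lra.
by apply/andP/idP => [[]//|]; split=> //; lra.
Qed.

Lemma lyapunov_stable_deSitter : lyapunov_stable F P (0, 1).
Proof.
move=> e e0; exists e => // z zT; rewrite deSitter_norm_lt// => z0 t t0.
by rewrite deSitter_norm_lt//; have := nonincreasing_deSitter zT t0; lra.
Qed.

(** A start with 1 - y < 1/2 keeps y >= 1/2, and 2 w + gamma x >= gamma (w + x) = gamma (1 - y)
    because gamma <= 2. Hence 1 - y decays at rate 3 gamma / 2. *)
Lemma future_attractor_deSitter : 0 < gamma -> future_attractor F P (0, 1).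
Proof.
move=> g0; split; first exact: lyapunov_stable_deSitter.
exists (1 / 2); first lra.
move=> z zT; rewrite deSitter_norm_lt// => z0.
apply: (@cvg_expR_decay _ _ _ _ (3 / 2 * gamma) 1).
  lra.
move=> t t0; have [x0 y0 w0] := trajectory_Psi t zT.
have decay : 1 - (z t).2 <=
    (1 - (z 0).2) * expR (- (3 / 2 * gamma) * (t - 0)).
  apply: (le_expR_of_derive_le t0
    (fun u _ => is_derive_deSitter u zT)) => u /andP[u0 _].
  have [x0' y0' w0'] := trajectory_Psi u zT.
  have y12 : 1 / 2 <= (z u).2.
    by have := nonincreasing_deSitter zT u0; lra.
  suff : gamma * (1 - (z u).2) * (1 / 2) <=
      (z u).2 * (2 - (2 - gamma) * (z u).1 - 2 * (z u).2) by lra.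
  have y1 : 0 <= 1 - (z u).2 by lra.
  rewrite mulrC ler_pM ?mulr_ge0//.
  have : 0 <= (2 - gamma) * (1 - (z u).1 - (z u).2) by rewrite mulr_ge0.
  lra.
have y0' : 1 - (z 0).2 <= 1 by have [] := trajectory_Psi 0 zT; lra.
have y1 : 0 <= 1 - (z t).2 by lra.
have xy : (z t).1 <= 1 - (z t).2 by lra.
have bound : 1 - (z t).2 <= 1 * expR (- (3 / 2 * gamma) * t).
  by rewrite (le_trans decay)// subr0 ler_wpM2r ?expR_ge0.
rewrite norm_pair_sub_le /= subr0 (ger0_norm x0) distrC (ger0_norm y1) bound.
by rewrite (le_trans xy).
Qed.

(** * Instability of the stiff point A and attraction in reversed time *)

Lemma unstable_stiff : unstable F P (0, 0).
Proof.
move=> /(_ (1 / 4)) []; first lra; move=> d d0 stab.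
(* The start (0, y0) lies within [d] of A and inside the triangle. *)
pose y0 := Num.min (d / 2) (1 / 2).
have y0_gt0 : 0 < y0 by rewrite lt_min; apply/andP; split; lra.
have y0d : y0 < d by rewrite gt_min; apply/orP; left; lra.
have y01 : y0 <= 1 / 2 by rewrite ge_min lexx orbT.
have [|z zT z0] := @Psi_flow (0, y0); first by apply/PsiP; split=> /=; lra.
have near0 t : 0 <= t -> (z t).1 < 1 / 4 /\ (z t).2 < 1 / 4.
  move=> t0; have := stab z zT _ t t0; rewrite !norm_pair_sub_lt z0 /=.
  rewrite !subr0 normr0 d0 gtr0_norm// => /(_ y0d) /andP[? ?].
  by split; rewrite (le_lt_trans (ler_norm _)).
(* At this time y0 e^(3t) >= y0 (1 + 3t) = y0 + 3, beyond the bound 1/4. *)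
pose t := y0^-1.
have t0 : 0 <= t by rewrite invr_ge0 ltW.
(* While x and y stay below 1/4, the growth rate of y is at least 6 - 6/4 - 6/4 = 3; the estimate is
   applied to - y. *)
have : - (z t).2 <= - (z 0).2 * expR (3 * (t - 0)).
  apply: (@le_expR_of_derive_le _ (- (snd \o z)) _ _ _ _ t0).
    move=> u _; apply: is_deriveN; apply: is_derive_snd.
    by case: zT => zS _; exact: zS.
  move=> u /andP[u0 _]; have [? ? ?] := trajectory_Psi u zT.
  have [? ?] := near0 u u0.
  rewrite vfield_nullclines [(- _) u]/(- (z u).2) mulrN lerN2 /= mulrC.
  rewrite ler_wpM2l//.
  have : 0 <= 3 * gamma * (z u).1.
    by rewrite !mulr_ge0//; lra.
  lra.
rewrite z0 /= subr0 mulNr lerN2.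
have : 1 <= y0 * expR (3 * t).
  have : y0 * (1 + 3 * t) <= y0 * expR (3 * t).
    by rewrite ler_pM2l// expR_ge1Dx.
  by rewrite mulrDr mulrCA divff ?lt0r_neq0//; lra.
by have [_ ?] := near0 t t0; lra.
Qed.

Lemma is_derive_time_reversed z t : trajectory (fun p => - F p) P z ->
  is_derive t 1 (fun s => (z s).1 + (z s).2)
    (- ((1 - (z t).1 - (z t).2)
        * (3 * (2 - gamma) * (z t).1 + 6 * (z t).2))).
Proof.
move=> [zS _]; have zD := zS t Logic.I.
have := is_deriveD (is_derive_fst zD) (is_derive_snd zD).
by move=> /is_derive_eq; apply; rewrite /vfield /=; ring.
Qed.

Lemma nonincreasing_time_reversed z s t :
  trajectory (fun p => - F p) P z -> s <= t ->
  (z t).1 + (z t).2 <= (z s).1 + (z s).2.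
Proof.
move=> zT st.
apply: (le_of_derive_le0 st (fun u _ => is_derive_time_reversed u zT)) => u _.
have [x0 y0 w0] := trajectory_Psi u zT.
by rewrite oppr_le0 mulr_ge0// addr_ge0// !mulr_ge0.
Qed.

(** The sum x + y bounds both coordinates and is at most twice their maximum, whence the radius e /
    2. From radius 1/4 it stays below 1/2, so w >= 1/2, and (2 - gamma) x + 2 y >= (2 - gamma) (x +
    y) gives the decay rate 3 (2 - gamma) / 2. *)
Lemma past_attractor_stiff : gamma < 2 -> past_attractor F P (0, 0).
Proof.
move=> g2; split.
  move=> e e0; exists (e / 2); first lra.
  move=> z zT + t t0; have := nonincreasing_time_reversed zT t0.
  have [? ? ?] := trajectory_Psi 0 zT; have [? ? ?] := trajectory_Psi t zT.
  rewrite !norm_pair_sub_lt /= !subr0 !ger0_norm// => ? /andP[? ?].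
  by apply/andP; split; lra.
exists (1 / 4); first lra.
move=> z zT; rewrite norm_pair_sub_lt /= !subr0 => /andP[].
have [x0 y0 w0] := trajectory_Psi 0 zT.
rewrite !ger0_norm// => x0_lt y0_lt.
apply: (@cvg_expR_decay _ _ _ _ (3 / 2 * (2 - gamma)) 1).
  lra.
move=> t t0; have [xt yt wt] := trajectory_Psi t zT.
have decay : (z t).1 + (z t).2 <=
    ((z 0).1 + (z 0).2) * expR (- (3 / 2 * (2 - gamma)) * (t - 0)).
  apply: (le_expR_of_derive_le t0
    (fun u _ => is_derive_time_reversed u zT)) => u /andP[u0 _].
  have [xu yu wu] := trajectory_Psi u zT.
  have ? := nonincreasing_time_reversed zT u0.
  suff : 1 / 2 * ((2 - gamma) * ((z u).1 + (z u).2)) <=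
      (1 - (z u).1 - (z u).2) * ((2 - gamma) * (z u).1 + 2 * (z u).2) by lra.
  have V_ge0 : 0 <= (2 - gamma) * ((z u).1 + (z u).2).
    by rewrite mulr_ge0// addr_ge0.
  have w12 : 1 / 2 <= 1 - (z u).1 - (z u).2 by lra.
  apply: ler_pM => //.
  have : 0 <= gamma * (z u).2 by rewrite mulr_ge0.
  lra.
have z0 : (z 0).1 + (z 0).2 <= 1 by lra.
have bound : (z t).1 + (z t).2 <= 1 * expR (- (3 / 2 * (2 - gamma)) * t).
  by rewrite (le_trans decay)// subr0 ler_wpM2r ?expR_ge0.
rewrite norm_pair_sub_le /= !subr0 !ger0_norm//.
by apply/andP; split; apply: le_trans bound; rewrite ?lerDl ?lerDr.
Qed.

(** * Critical points and linearization at B *)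

(** Strict bounds on gamma isolate the three points: for gamma = 0 the whole line x + y = 1 is
    critical, for gamma = 2 the whole line y = 0. *)
Lemma critical_pointP p : 0 < gamma < 2 ->
  critical_point F p <-> p = (0, 0) \/ p = (1, 0) \/ p = (0, 1).
Proof.
case: p => x y /andP[g0 g2]; rewrite /critical_point vfield_nullclines /=.
split; last first.
  by move=> [[-> ->]|[[-> ->]|[-> ->]]];
    apply: injective_projections => /=; ring.
move=> [/eqP + /eqP]; rewrite !mulf_eq0.
move=> /orP[/eqP ->|/eqP nx] /orP[/eqP y0|/eqP ny].
- by left; rewrite y0.
- by right; right; congr pair; lra.
- right; left; subst y; congr pair; apply/eqP; rewrite -subr_eq0.
  have : (2 - gamma) * (1 - x) = 0 by lra.
  by move=> /eqP; rewrite mulf_eq0 => /orP[/eqP|/eqP] ?; apply/eqP; lra.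
(* Both growth rates vanish only if 3 (2 - gamma) = 6, that is gamma = 0. *)
- by exfalso; lra.
Qed.

(** The value is the Jacobian matrix at [p] applied to [v]. *)
Lemma is_derive_vfield p v : is_derive p v F
  ((3 * (2 - gamma) * (1 - 2 * p.1) - 6 * p.2) * v.1 - 6 * p.1 * v.2,
   (6 - 12 * p.2 - 3 * (2 - gamma) * p.1) * v.2
     - 3 * (2 - gamma) * p.2 * v.1).
Proof.
have xD := is_derive_fst (is_derive_id p v).
have yD := is_derive_snd (is_derive_id p v).
have cD (c : R) := is_derive_cst c p v.
pose a : R := 3 * (2 - gamma).
have := is_derive_pair
  (is_deriveB (is_deriveM (is_deriveZ a xD) (is_deriveB (cD 1) xD))
     (is_deriveM (is_deriveZ 6 xD) yD))
  (is_deriveB (is_deriveM (is_deriveZ 6 yD) (is_deriveB (cD 1) yD))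
     (is_deriveM (is_deriveZ a yD) xD)).
move=> /is_derive_eq; apply; rewrite /GRing.scale /= /a.
congr pair.
  rewrite -[LHS]/(3 * (2 - gamma) * p.1 * (0 - v.1) +
    (1 - p.1) * (3 * (2 - gamma) * v.1) - (6 * p.1 * v.2 + p.2 * (6 * v.1))).
  ring.
rewrite -[LHS]/(6 * p.2 * (0 - v.2) + (1 - p.2) * (6 * v.2) -
  (3 * (2 - gamma) * p.2 * v.1 + p.1 * (3 * (2 - gamma) * v.2))).
ring.
Qed.

(** Differentiability is what identifies ['d F p v] with the directional derivative computed
    above. *)
Lemma differentiable_vfield p : differentiable F p.
Proof.
have fD : differentiable (fst : R * R -> R) p.
  apply: linear_differentiable => q; exact: cvg_fst.
have sD : differentiable (snd : R * R -> R) p.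
  apply: linear_differentiable => q; exact: cvg_snd.
have cD (c : R) : differentiable (cst c : R * R -> R) p.
  exact: differentiable_cst.
apply: differentiable_pair; apply: differentiableB;
  repeat (apply: differentiableM => //).
all: by apply: differentiableB.
Qed.

Lemma saddle_point_matter : 0 < gamma < 2 -> saddle_point F (1, 0).
Proof.
move=> g02; move/andP: (g02) => [g0 g2]; split.
- by apply/critical_pointP => //; right; left.
- exact: differentiable_vfield.
(* At B the Jacobian is upper triangular. Its eigenvectors point along the two edges y = 0 and x + y
   = 1 of the triangle. *)
have eigen (v : R * R) a : v != 0 ->
    (- 3 * (2 - gamma) * v.1 - 6 * v.2, 3 * gamma * v.2) = a *: v ->
    lin_eigenvalue F (1, 0) a.
  move=> v0 va; exists v => //.
  rewrite -deriveE; last exact: differentiable_vfield.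
  have [_ ->] := is_derive_vfield (1, 0) v.
  by rewrite -va; congr pair => /=; ring.
exists (- 3 * (2 - gamma)), (3 * gamma); split; [lra|lra| |].
- apply: (eigen (1, 0)); first by rewrite xpair_eqE oner_eq0.
  by congr pair => /=; rewrite /GRing.scale /=; ring.
- apply: (eigen (1, - 1)); first by rewrite xpair_eqE oner_eq0.
  by congr pair => /=; rewrite /GRing.scale /=; ring.
Qed.

End Flow.

(** * From the field equations to the density parameters *)

Section FieldEquations.
Variables (R : realType) (gamma omega n Lambda : R) (I : set R).
Variables (H rho phi : R -> R).
Hypothesis sb : saez_ballester gamma omega n Lambda I H rho phi.
Variable t : R.
Hypotheses (It : I t) (Ht0 : H t != 0).
Local Notation Om := (Omega_m H rho).
Local Notation OL := (Omega_L Lambda H).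

(** The Friedmann constraint eliminates the kinetic term, and with it the scalar field, from the
    equation for the derivative of [H]. *)
Lemma raychaudhuri_Lambda :
  derive1 H t = ((2 - gamma) * rho t + 2 * Lambda - 6 * H t ^+ 2) / 2.
Proof. have := sb_friedmann sb It; have := sb_raychaudhuri sb It; lra. Qed.

(** Quotient rule shared by both density parameters, with [f] either [rho] or the constant
    [Lambda]. *)
Lemma is_derive_density (f : R -> R) df : is_derive t 1 f df ->
  is_derive t 1 (fun s => f s / (3 * H s ^+ 2))
    (df / (3 * H t ^+ 2) - 2 * f t * derive1 H t / (3 * H t ^+ 3)).
Proof.
move=> fD.
have HD : is_derive t 1 H (derive1 H t).
  by rewrite derive1E; apply: derivableP; exact: (sb_derivable_H sb It).
have H2D : is_derive t 1 (fun s => 3 * H s ^+ 2) (6 * H t * derive1 H t).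
  have := is_deriveZ 3 (is_deriveM HD HD).
  by move=> /is_derive_eq; apply; rewrite /GRing.scale /=; ring.
have H2n0 : 3 * H t ^+ 2 != 0 by rewrite mulf_neq0 ?expf_neq0.
have := is_deriveM fD (@is_deriveV _ (fun s => 3 * H s ^+ 2) _ _ _ H2n0 H2D).
by move=> /is_derive_eq; apply; rewrite /GRing.scale /=; field.
Qed.

Lemma is_derive_Omega_m : is_derive t 1 Om
  (H t * (3 * (2 - gamma) * Om t * (1 - Om t) - 6 * Om t * OL t)).
Proof.
have rhoD : is_derive t 1 rho (- (3 * gamma * H t * rho t)).
  apply: is_derive_eq.
    by apply: derivableP; exact: (sb_derivable_rho sb It).
  by rewrite -derive1E; have := sb_continuity sb It; lra.
move/is_derive_density/is_derive_eq: rhoD; apply.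
by rewrite raychaudhuri_Lambda /Omega_m /Omega_L; field.
Qed.

Lemma is_derive_Omega_L : is_derive t 1 OL
  (H t * (6 * OL t * (1 - OL t) - 3 * (2 - gamma) * OL t * Om t)).
Proof.
move/is_derive_density/is_derive_eq: (is_derive_cst Lambda t 1); apply.
by rewrite mul0r sub0r /cst raychaudhuri_Lambda /Omega_m /Omega_L; field.
Qed.

Lemma tau_deriveE (f : R -> R) df :
  is_derive t 1 f (H t * df) -> tau_derive H f t = df.
Proof.
by case=> _ fD; rewrite /tau_derive derive1E fD mulrAC divff ?mul1r.
Qed.

Lemma deceleration_Omega :
  - 1 - derive1 H t / H t ^+ 2 = deceleration gamma (Om t, OL t).
Proof.
by rewrite raychaudhuri_Lambda /deceleration /Omega_m /Omega_L /=; field.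
Qed.

(** By the Friedmann constraint the third density w is the kinetic energy over [3 * H t ^+ 2], so
    the triangle means nonnegativity of the three energy densities. *)
Lemma Psi_Omega : @Psi R (Om t, OL t) <->
  [/\ 0 <= rho t, 0 <= Lambda &
      0 <= omega / 2 * rpow (phi t) n * derive1 phi t ^+ 2].
Proof.
have H2 : 0 < 3 * H t ^+ 2 by rewrite mulr_gt0// exprn_even_gt0.
set K := omega / 2 * rpow (phi t) n * derive1 phi t ^+ 2.
have KE : 1 - Om t - OL t = K / (3 * H t ^+ 2).
  have -> : K = 3 * H t ^+ 2 - rho t - Lambda.
    by have := sb_friedmann sb It; rewrite -/K; lra.
  by rewrite /Omega_m /Omega_L; field.
have Vge0 (x : R) : (0 <= x / (3 * H t ^+ 2)) = (0 <= x).
  by rewrite pmulr_lge0 ?invr_gt0.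
by rewrite PsiP /= KE !Vge0.
Qed.

End FieldEquations.

(** * The autonomous system and the nature of its critical points *)

Theorem mainTheorem3 (R : realType) (gamma omega n Lambda : R)
    (hgamma : 0 <= gamma <= 2) :
  let A : R * R := (0, 0) in
  let B : R * R := (1, 0) in
  let C : R * R := (0, 1) in
  let F := vfield gamma in
  let P := @Psi R in
  (forall (I : set R) (H rho phi : R -> R),
     open I -> saez_ballester gamma omega n Lambda I H rho phi ->
     forall t : R, I t -> H t != 0 ->
     let Om := Omega_m H rho in
     let OL := Omega_L Lambda H in
     [/\ derivable Om t 1 /\ derivable OL t 1,
         tau_derive H Om t
         = 3 * (2 - gamma) * Om t * (1 - Om t) - 6 * Om t * OL t,
         tau_derive H OL t
         = 6 * OL t * (1 - OL t) - 3 * (2 - gamma) * OL t * Om t,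
         - 1 - derive1 H t / H t ^+ 2 = deceleration gamma (Om t, OL t) &
         P (Om t, OL t) <->
         [/\ 0 <= rho t, 0 <= Lambda &
             0 <= omega / 2 * rpow (phi t) n * derive1 phi t ^+ 2]])
  /\ phase_space F P
  /\ (forall p, p = A \/ p = B \/ p = C -> P p /\ critical_point F p)
  /\ (0 < gamma < 2 ->
      forall p, critical_point F p <-> p = A \/ p = B \/ p = C)
  /\ [/\ unstable F P A,
         gamma < 2 -> past_attractor F P A &
         deceleration gamma A = 2]
  /\ ((0 < gamma < 2 -> saddle_point F B) /\
      deceleration gamma B = - 1 + 3 * gamma / 2)
  /\ [/\ lyapunov_stable F P C,
         0 < gamma -> future_attractor F P C &
         deceleration gamma C = - 1].
Proof.
move=> A B C F P; rewrite {}/A {}/B {}/C {}/F {}/P; have [g0 g2] := andP hgamma.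
split.
  move=> I H rho phi _ sb t It Ht0.
  have OmD := is_derive_Omega_m sb It Ht0.
  have OLD := is_derive_Omega_L sb It Ht0.
  split; [by case: OmD; case: OLD| | | |].
  - exact: (tau_deriveE Ht0 OmD).
  - exact: (tau_deriveE Ht0 OLD).
  - exact: (deceleration_Omega sb It Ht0).
  - exact: (Psi_Omega sb It Ht0).
split; first exact: phase_space_Psi.
split.
  move=> p ABC; split.
    by case: ABC => [|[|]] ->; apply/PsiP; rewrite /= ?subr0 ?subrr.
  rewrite /critical_point vfield_nullclines.
  by case: ABC => [|[|]] ->; apply: injective_projections => /=; ring.
split; first by move=> g02 p; exact: critical_pointP.
split.
  split; first exact: unstable_stiff.
    exact: past_attractor_stiff.
  by rewrite /deceleration /=; ring.
split.
  split; first exact: saddle_point_matter.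
  by rewrite /deceleration /=; field.
split; first exact: lyapunov_stable_deSitter.
  exact: future_attractor_deSitter.
by rewrite /deceleration /=; ring.
Qed.
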